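(* Let $Y$, $K$, $X$, $a$, $b$, $G$, $B$, $H$ satisfy property (K) and properties (A1)--(A4) listed in the context. Assume further: (a) $H'$ is continuous with respect to the weak topology on $X^\star$ in the sense that, for any sequence $\{z^n\}_{n\ge0}\subset K$ with a limit $z^\star\in K$ (in the norm of $Y$), it holds that $$\lim_{n\to\infty}\langle H'(z^n),w\rangle=\langle H'(z^\star),w\rangle\qquad\forall w\in X;$$ (b) the damping strategy $\delta:K\to(0,\infty)$ is such that the iterates $\{u^n\}_{n\ge0}$ of the damped Kačanov iteration $$u^{n+1}=u^n-\delta(u^n)\rho^n,\qquad n\ge0,$$ where $\rho^n\in X$ is the unique element with $a(u^n;\rho^n,w)=\langle H'(u^n),w\rangle$ for all $w\in X$, satisfy $\delta(u^n)\ge\delta_{\min}>0$ and $$H(u^n)-H(u^{n+1})\ge\gamma\|u^{n+1}-u^n\|_Y^2\qquad\forall n\ge0,$$ for some constants $\delta_{\min},\gamma>0$ independent of $n$. Then, for any initial guess $u^0\in K$, the damped Kačanov iteration $\{u^n\}_{n\ge 0}$ converges (in $Y$) to the unique solution $u^\star\in K$ of $$\langle H'(u^\star),v\rangle=0\qquad\forall v\in X .$$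
   Context: $Y$ is a reflexive real Banach space with norm $\|\cdot\|_Y$, and $K\subset Y$ is a non-empty closed convex subset. Property (K): the set $X:=\{u-v:\,u,v\in K\}$ is a closed linear subspace of $Y$, and $x+y\in K$ for all $x\in X$, $y\in K$. A functional $\Phi:K\to\mathbb{R}$ is Gâteaux continuously differentiable if it has a Gâteaux derivative $\Phi'(u)\in Y^\star$ at every $u\in K$, meaning $\lim_{t\downarrow0}\frac{\Phi(u+t(v-u))-\Phi(u)}{t}=\langle \Phi'(u),v-u\rangle$ for all $v\in K$, and $u\mapsto\Phi'(u)$ is continuous from $K$ to $Y^\star$. Duality products are denoted $\langle\cdot,\cdot\rangle$. Let $a:K\times Y\times X\to\mathbb{R}$ and $b:K\times X\to\mathbb{R}$ be mappings. (A1) For any $u\in K$, $a(u;\cdot,\cdot)$ is a bilinear form on $Y\times X$, and $b(u,\cdot)\in X^\star$; one writes $b(u,\cdot)=\langle b(u),\cdot\rangle$. (A2) There are constants $\alpha,\beta>0$ such that for every $u\in K$: $a(u;v,w)\le\beta\|v\|_Y\|w\|_Y$ for all $v\in Y$, $w\in X$, and $a(u;v,v)\ge\alpha\|v\|_Y^2$ for all $v\in X$. (A3) There are Gâteaux continuously differentiable functionals $G:K\to\mathbb{R}$ and $B:K\to\mathbb{R}$ such that, for all $u\in K$, $G'(u)|_X=a(u;u,\cdot)$ and $B'(u)|_X=b(u)$ in $X^\star$. (A4) The functional $H:K\to\mathbb{R}$, $H(u):=G(u)-B(u)$, satisfies, for some constant $\nu>0$, $\langle H'(u)-H'(v),u-v\rangle\ge\nu\|u-v\|_Y^2$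 for all $u,v\in K$. In particular $H'(u)|_X=a(u;u,\cdot)-b(u)$ in $X^\star$. By (A2) and the Lax--Milgram theorem $\rho^n$ exists and is unique, and by (K) all iterates lie in $K$. *)

(* Defs.v *)
From HB Require Import structures.
From mathcomp Require Import all_boot all_order all_algebra.
From mathcomp Require Import all_classical all_reals all_analysis.

Set Implicit Arguments.
Unset Strict Implicit.
Unset Printing Implicit Defensive.

Import Order.TTheory GRing.Theory Num.Theory.
Import numFieldNormedType.Exports.

Local Open Scope classical_set_scope.
Local Open Scope ring_scope.

Section Dual.
Variables (R : realType) (V : normedModType R).

Definition dual_pred : {pred V -> R^o} :=
  [pred f : V -> R^o | `[< linear f /\ continuous f >]].

Record dual := Dual { dual_fun :> V -> R^o ; _ : dual_fun \in dual_pred }.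

HB.instance Definition _ := [isSub for dual_fun].
HB.instance Definition _ := [Choice of dual by <:].

Lemma dual_submod_closed : submod_closed dual_pred.
Proof.
split; rewrite ?inE.
  by split; [move=> k x y /=; rewrite scaler0 addr0|move=> x; exact: cvg_cst].
move=> k f g /[!inE] -[linf cf] [ling cg]; split.
  move=> c x y; change ((k *: f + g) (c *: x + y)) with
    (k *: f (c *: x + y) + g (c *: x + y)).
  change ((k *: f + g) x) with (k *: f x + g x).
  change ((k *: f + g) y) with (k *: f y + g y).
  rewrite linf ling !scalerDr !scalerA (mulrC c k) -!addrA; congr (_ + _).
  by rewrite addrCA.
by move=> x; apply: cvgD; [apply: cvgZr; exact: cf|exact: cg].
Qed.

HB.instance Definition _ :=
  GRing.isSubmodClosed.Build _ _ dual_pred dual_submod_closed.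
HB.instance Definition _ := [SubChoice_isSubLmodule of dual by <:].

Definition dual_norm (f : dual) : R :=
  sup [set `|f x| | x in [set x : V | `|x| <= 1]].

Lemma dual_is_linear (f : dual) : linear f.
Proof. by case: f => f /= /[!inE] -[]. Qed.

HB.instance Definition _ (f : dual) :=
  GRing.isLinear.Build R V R^o *:%R (dual_fun f) (dual_is_linear f).

Lemma dual_continuous (f : dual) : continuous f.
Proof. by case: f => f /= /[!inE] -[]. Qed.

Lemma dual_has_sup (f : dual) :
  has_sup [set `|f x| | x in [set x : V | `|x| <= 1]].
Proof.
split; first by exists `|f 0|; exists 0 => //=; rewrite normr0.
have f0 : {for 0, continuous f} by exact: dual_continuous.
have /bounded_funP/(_ 1)[M fM] := continuous_linear_bounded 0 f0.
by exists M => _ [x x1 <-]; exact: fM.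
Qed.

Lemma dual_norm_ub (f : dual) (x : V) : `|x| <= 1 -> `|f x| <= dual_norm f.
Proof.
by move=> x1; apply: (ub_le_sup (dual_has_sup f).2); exists x.
Qed.

Lemma dual_norm_le (f : dual) (M : R) :
  (forall x, `|x| <= 1 -> `|f x| <= M) -> dual_norm f <= M.
Proof.
move=> fM; apply: ge_sup; first exact: (dual_has_sup f).1.
by move=> _ [x x1 <-]; exact: fM.
Qed.

Lemma dual_normD (f g : dual) : dual_norm (f + g) <= dual_norm f + dual_norm g.
Proof.
apply: dual_norm_le => x x1.
by rewrite (le_trans (ler_normD _ _))// lerD// dual_norm_ub.
Qed.

Let dual_normZ_le (k : R) (f : dual) :
  dual_norm (k *: f) <= `|k| * dual_norm f.
Proof.
apply: dual_norm_le => x x1.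
by rewrite [leLHS](normrM k (f x)) ler_wpM2l// dual_norm_ub.
Qed.

Lemma dual_normZ (k : R) (f : dual) :
  dual_norm (k *: f) = `|k| * dual_norm f.
Proof.
apply/eqP; rewrite eq_le dual_normZ_le /=.
have [->|k0] := eqVneq k 0.
  rewrite normr0 mul0r.
  have /= := @dual_norm_ub (0 *: f) 0.
  by rewrite normr0 => /(_ ler01); exact: le_trans.
rewrite -ler_pdivlMl ?normr_gt0// -normfV.
by rewrite -[leLHS]/(dual_norm f) -{1}[f]scale1r -(mulVf k0) -scalerA dual_normZ_le.
Qed.

Lemma dual_norm0_eq0 (f : dual) : dual_norm f = 0 -> f = 0.
Proof.
move=> f0; apply/val_inj/funext => x; rewrite [RHS]/=.
have [->|x0] := eqVneq x 0; first exact: (linear0 f).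
have nx0 : `|x| != 0 by rewrite normr_eq0.
have : `|f (`|x|^-1 *: x)| <= 0.
  by rewrite -f0 dual_norm_ub// normrZ normfV normr_id mulVf.
rewrite normr_le0 linearZ/= mulf_eq0 invr_eq0 (negbTE nx0)/=.
by move=> /eqP.
Qed.

HB.instance Definition _ :=
  Lmodule_isNormed.Build R dual dual_normD dual_normZ dual_norm0_eq0.

End Dual.

Definition reflexive_space (R : realType) (V : normedModType R) :=
  forall F : dual (dual V), exists x : V, forall f : dual V, F f = f x.

(* Maps defined on K or X are represented by total functions on Y; only their
   values on K (or X) are ever constrained or used. *)
Section Kacanov.
Variables (R : realType) (Y : completeNormedModType R).
Implicit Types (K X : set Y) (a : Y -> Y -> Y -> R) (b : Y -> Y -> R).
Implicit Types (Phi G B H : Y -> R) (dPhi dG dB dH : Y -> dual Y).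

Definition difference_set K : set Y := [set u - v | u in K & v in K].

Definition closed_subspace X :=
  [/\ closed X, X 0 &
      forall (k : R) (x y : Y), X x -> X y -> X (k *: x + y)].

Definition property_K K :=
  closed_subspace (difference_set K) /\
  forall x y, difference_set K x -> K y -> K (x + y).

Definition linear_on X (f : Y -> R) :=
  forall (k : R) (x y : Y), X x -> X y -> f (k *: x + y) = k * f x + f y.

(* f|_X belongs to X^* *)
Definition in_dual_on X (f : Y -> R) :=
  linear_on X f /\ {within X, continuous f}.

(* This determines dPhi u only on the difference set of K, so derivatives are
   carried as explicit data rather than through a derivative operator. *)
Definition is_gateaux_derivative K Phi dPhi :=
  forall u v, K u -> K v ->
    (Phi (u + t *: (v - u)) - Phi u) / t @[t --> 0^'+] --> dPhi u (v - u).

Definition gateaux_C1 K Phi dPhi :=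
  is_gateaux_derivative K Phi dPhi /\ {within K, continuous dPhi}.

Definition property_A1 K a b :=
  let X := difference_set K in
  forall u, K u ->
    [/\ forall w, X w -> linear_on setT (a u ^~ w),
        forall v, linear_on X (a u v) &
        in_dual_on X (b u)].

Definition property_A2 K a :=
  let X := difference_set K in
  exists alpha beta : R, [/\ 0 < alpha, 0 < beta &
    forall u, K u ->
      (forall v w, X w -> a u v w <= beta * `|v| * `|w|) /\
      (forall v, X v -> alpha * `|v| ^+ 2 <= a u v v)].

Definition property_A3 K a b G B dG dB :=
  let X := difference_set K in
  [/\ gateaux_C1 K G dG, gateaux_C1 K B dB &
      forall u w, K u -> X w -> dG u w = a u u w /\ dB u w = b u w].

Definition property_A4 K H dH :=
  is_gateaux_derivative K H dH /\
  exists2 nu : R, 0 < nu &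
    forall u v, K u -> K v ->
      nu * `|u - v| ^+ 2 <= (dH u - dH v) (u - v).

Definition weakly_continuous_on K dH :=
  let X := difference_set K in
  forall (z : nat -> Y) (zstar : Y),
    (forall n, K (z n)) -> K zstar -> z n @[n --> \oo] --> zstar ->
    forall w, X w -> dH (z n) w @[n --> \oo] --> dH zstar w.

(* The description operator xget picks the unique rho in X given by the
   Lax-Milgram theorem. *)
Definition kacanov_direction K a dH (u : Y) : Y :=
  let X := difference_set K in
  xget 0 [set rho | X rho /\ forall w, X w -> a u rho w = dH u w].

Definition kacanov K a dH (delta : Y -> R) (u0 : Y) (n : nat) : Y :=
  iter n (fun u => u - delta u *: kacanov_direction K a dH u) u0.

Definition damping_condition H (delta : Y -> R) (u : nat -> Y) :=
  exists delta_min gamma : R, [/\ 0 < delta_min, 0 < gamma &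
    forall n, delta_min <= delta (u n) /\
      gamma * `|u n.+1 - u n| ^+ 2 <= H (u n) - H (u n.+1)].

Definition solves K dH (u : Y) :=
  K u /\ forall v, difference_set K v -> dH u v = 0.

End Kacanov.

(* Main.v *)
Require Import Defs.
From mathcomp Require Import all_boot all_order all_algebra.
From mathcomp Require Import all_classical all_reals all_analysis.
From mathcomp Require Import ring lra.
Import Order.TTheory GRing.Theory Num.Theory.
Import numFieldNormedType.Exports.
Local Open Scope classical_set_scope.
Local Open Scope ring_scope.

(** Two facts carry the proof. The first is that strong monotonicity of the
    derivative dH makes H at least quadratically convex along segments of K
    ([strongly_monotone_lower_bound]), hence bounded below. The damping
    condition makes H decrease along the iteration by at least a multiple of
    the squared step, so the decrements H(u_n) - H(u_(n+1)) tend to 0, and since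
    the step is delta(u_n) rho_n with delta(u_n) bounded away from 0, they
    dominate a fixed multiple of the squared norm of rho_n.

    The second is that rho_n, being the Lax-Milgram representative of dH(u_n),
    controls it: dH(u_n) has norm at most beta |rho_n| on X. With strong
    monotonicity applied to u_m and u_n this gives
    nu |u_m - u_n| <= beta (|rho_m| + |rho_n|), so the iterates form a Cauchy
    sequence. Their limit lies in the closed set K, and by the weak continuity
    of dH the derivative vanishes on X there. The solution is thus produced by
    the iteration itself, and strong monotonicity makes it unique.

    That rho_n represents dH(u_n) rests on the Lax-Milgram theorem on the
    closed subspace X ([lax_milgram]), for a form that need not be symmetric.
    The symmetric case ([riesz]) is proved by minimizing the quadratic energy;
    coercivity and completeness make minimizing sequences converge. The general
    case follows from two uses of the symmetric one: the form induces an
    operator A on X, representing it in the inner product given by its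
    symmetric part, and the least-squares equation for A is again a symmetric
    coercive problem. *)

(** * Bounded linear functionals on a closed subspace *)


Section LinearOn.
Context {R : realType} {Y : completeNormedModType R}.
Implicit Types (X : set Y) (f : Y -> R).

Lemma subspaceZ X (k : R) (x : Y) : closed_subspace X -> X x -> X (k *: x).
Proof. by move=> [_ X0 XD] Xx; rewrite -[_ *: _]addr0; exact: XD. Qed.

Lemma subspaceD X (x y : Y) : closed_subspace X -> X x -> X y -> X (x + y).
Proof. by move=> [_ _ XD] Xx Xy; rewrite -[x]scale1r; exact: XD. Qed.

Lemma subspaceB X (x y : Y) : closed_subspace X -> X x -> X y -> X (x - y).
Proof.
by move=> sX Xx Xy; apply: subspaceD => //; rewrite -scaleN1r; exact: subspaceZ.
Qed.

Lemma linear_on_comb X f (k l : R) (x y : Y) :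
  closed_subspace X -> linear_on X f -> X x -> X y ->
  f (k *: x + l *: y) = k * f x + l * f y.
Proof.
move=> sX lf Xx Xy; have [_ X0 _] := sX.
have f0 : f 0 = 0.
  have := lf 1 0 0 X0 X0; rewrite scaler0 addr0 mul1r => /esym/eqP.
  by rewrite -subr_eq0 addrK => /eqP.
rewrite lf//; last exact: subspaceZ.
by congr (_ + _); rewrite -[l *: y]addr0 lf// f0 addr0.
Qed.

Lemma linear_onB X f (x y : Y) :
  closed_subspace X -> linear_on X f -> X x -> X y -> f (x - y) = f x - f y.
Proof.
move=> sX lf Xx Xy.
have := linear_on_comb X f 1 (-1) x y sX lf Xx Xy.
by rewrite scale1r scaleN1r mul1r mulN1r.
Qed.

(** Boundedness replaces the continuity of [in_dual_on], since the estimates use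
    the constant and not the topology of [X]. *)
Definition bounded_linear_on X f :=
  linear_on X f /\ exists L : R, forall x, X x -> `|f x| <= L * `|x|.

Lemma bounded_linear_on_cvg X f (v : nat -> Y) (x : Y) :
  closed_subspace X -> bounded_linear_on X f ->
  (forall n, X (v n)) -> X x -> v n @[n --> \oo] --> x ->
  f (v n) @[n --> \oo] --> f x.
Proof.
move=> sX [lf [L fL]] Xv Xx vx.
apply/cvgrPdist_le => e e0 /=.
have L0 : 0 < `|L| + 1 by rewrite ltr_wpDl.
have eL : 0 < e / (`|L| + 1) by rewrite divr_gt0.
near=> n; rewrite -(linear_onB X)//.
apply: (le_trans (fL _ (subspaceB X _ _ sX Xx (Xv n)))).
apply: (@le_trans _ _ ((`|L| + 1) * `|x - v n|)).
  by rewrite ler_wpM2r// (le_trans (ler_norm _))// lerDl.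
rewrite mulrC -ler_pdivlMr//; near: n.
by move/cvgrPdist_le : vx => /(_ _ eL).
Unshelve. all: end_near. Qed.

(** Both the minimizing sequences of a quadratic energy and the damped iterates
    come with a bound on squared distances, so this is the form in which
    completeness gets used. *)
Lemma cvg_of_sqr_bound (c : R) (e : nat -> R) (v : nat -> Y) :
  0 < c -> e n @[n --> \oo] --> 0 ->
  (forall m n, c * `|v m - v n| ^+ 2 <= e m + e n) -> cvgn v.
Proof.
move=> c0 e0 vle; apply/cauchy_cvgP/cauchy_exP => eps eps0.
have d0 : 0 < c * eps ^+ 2 / 2 by rewrite divr_gt0// mulr_gt0// exprn_gt0.
move/cvgrPdist_lt : e0 => /(_ _ d0)[N _ Ne].
exists (v N), N => // n /= Nn; rewrite -ball_normE /=.
rewrite -(ltr_pXn2r (_ : 0 < 2)%N) ?nnegrE ?normr_ge0 ?(ltW eps0)//.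
rewrite -(ltr_pM2l c0); apply: (le_lt_trans (vle N n)).
have := Ne N (leqnn N); have := Ne n Nn; rewrite /= !sub0r !normrN => h1 h2.
have := ler_norm (e N); have := ler_norm (e n); lra.
Qed.

End LinearOn.

(** * The Lax-Milgram theorem on a closed subspace *)

Section LaxMilgram.
Context {R : realType} {Y : completeNormedModType R}.
Implicit Types (X : set Y) (f : Y -> R) (S : Y -> Y -> R).

Definition bounded_coercive_form X S (alpha beta : R) :=
  [/\ forall w, X w -> linear_on X (S ^~ w),
      forall v, X v -> linear_on X (S v),
      forall v w, X v -> X w -> `|S v w| <= beta * `|v| * `|w| &
      forall v, X v -> alpha * `|v| ^+ 2 <= S v v].

Lemma coercive_eq0 X S (alpha beta : R) (v : Y) :
  0 < alpha -> bounded_coercive_form X S alpha beta -> X v -> S v v = 0 ->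
  v = 0.
Proof.
move=> a0 [_ _ _ co] Xv Sv.
have := co v Xv; rewrite Sv pmulr_rle0// => h.
by apply/eqP; rewrite -normr_eq0 -sqrf_eq0 eq_le h sqr_ge0.
Qed.

(** The same expansion serves the parallelogram identity ([k] = 1 and
    [k] = 1/2) and the Euler equation ([k] arbitrary) of the energy
    S(v, v) - 2 f(v). *)
Lemma energy_expand X S f (v d : Y) (k : R) :
  closed_subspace X ->
  (forall w, X w -> linear_on X (S ^~ w)) ->
  (forall w, X w -> linear_on X (S w)) ->
  (forall v w, X v -> X w -> S v w = S w v) -> linear_on X f ->
  X v -> X d ->
  S (v + k *: d) (v + k *: d) - 2 * f (v + k *: d) =
  (S v v - 2 * f v) + 2 * k * (S v d - f d) + k ^+ 2 * S d d.
Proof.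
move=> sX Sl Sr sym lf Xv Xd.
have Xk : X (v + k *: d) by apply: subspaceD => //; exact: subspaceZ.
have E g : linear_on X g -> g (v + k *: d) = g v + k * g d.
  move=> lg; have := linear_on_comb X g 1 k v d sX lg Xv Xd.
  by rewrite scale1r mul1r.
rewrite (E _ (Sl _ Xk)) (E _ (Sr _ Xv)) (E _ (Sr _ Xd)) (E _ lf) (sym d v)//.
ring.
Qed.

(** The energy J(v) = S(v, v) - 2 f(v) is bounded below by coercivity. By the
    parallelogram identity the distance of two near-minimizers is controlled by
    their excess energies, so a minimizing sequence converges. Passing to the
    limit in J(v_n + k w) >= inf J for all k gives the Euler equation
    S(r, w) = f(w). *)
Lemma riesz X S (alpha beta : R) f :
  closed_subspace X -> 0 < alpha -> bounded_coercive_form X S alpha beta ->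
  (forall v w, X v -> X w -> S v w = S w v) -> bounded_linear_on X f ->
  exists2 r, X r & forall w, X w -> S r w = f w.
Proof.
move=> sX a0 [Sl Sr Sb co] sym [lf [L fL]]; have [Xc X0 _] := sX.
pose J v := S v v - 2 * f v.
have JE v d k : X v -> X d ->
    J (v + k *: d) = J v + 2 * k * (S v d - f d) + k ^+ 2 * S d d.
  by move=> Xv Xd; exact: (energy_expand X).
pose E := [set J v | v in X].
have lbE : has_lbound E.
  exists (- (L ^+ 2 / alpha)) => _ [v Xv <-].
  have h1 := co v Xv; have h2 := le_trans (ler_norm _) (fL v Xv).
  apply: (@le_trans _ _ (alpha * `|v| ^+ 2 - 2 * (L * `|v|))); last first.
    by rewrite /J; lra.
  (* Completing the square. *)
  rewrite -subr_ge0 [leRHS](_ : _ = (alpha * `|v| - L) ^+ 2 / alpha).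
    by rewrite divr_ge0 ?sqr_ge0// ltW.
  by field; rewrite gt_eqF.
have infE : has_inf E by split => //; exists (J 0), 0.
have Jm v : X v -> inf E <= J v by move=> Xv; apply: ge_inf => //; exists v.
have /choice[v vP] n : exists v, X v /\ J v < inf E + n.+1%:R^-1.
  have [|_ [v Xv <-] ?] := @inf_adherent _ E n.+1%:R^-1 _ infE;
    last by exists v.
  by rewrite invr_gt0.
have vcvg : cvgn v.
  apply: (@cvg_of_sqr_bound _ _ (alpha / 2) (fun n => n.+1%:R^-1)).
  - by rewrite divr_gt0.
  - exact: cvg_harmonic.
  move=> m n; have [[Xm Jvm] [Xn Jvn]] := (vP m, vP n).
  have Xd : X (v m - v n) by exact: subspaceB.
  (* Comparing the energies at v_m, at v_n and at their midpoint eliminates the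
     linear term of the expansion around v_n. *)
  have := JE (v n) _ 1 Xn Xd; rewrite scale1r [v n + _]addrC subrK => E1.
  have E2 := JE (v n) _ 2^-1 Xn Xd.
  have Xmid : X (v n + 2^-1 *: (v m - v n)).
    by apply: subspaceD => //; exact: subspaceZ.
  have := Jm _ Xmid => Jmid; have := co _ Xd.
  set x := S (v m - v n) (v m - v n) in E1 E2 *.
  set y := S (v n) _ - _ in E1 E2 *.
  have q : 2 * 2^-1 * y = y by rewrite divff ?mul1r.
  have q2 : 2^-1 ^+ 2 * x = x / 4 by field.
  rewrite q q2 in E2; rewrite mulr1 expr1n mul1r in E1.
  move: (J _) (J (v m)) (J (v n)) (inf E) (m.+1%:R^-1) (n.+1%:R^-1)
    E1 E2 Jvm Jvn Jmid => jmid jm jn i em en E1 E2 Jvm Jvn Jmid.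
  lra.
have Xv : X (limn v).
  apply: (closed_cvg X Xc _ _ vcvg).
  by apply: nearW => n; exact: (vP n).1.
exists (limn v) => // w Xw.
set p := S (limn v) w - f w.
have pn : S (v n) w - f w @[n --> \oo] --> p.
  apply: cvgB; last exact: cvg_cst.
  apply: (@bounded_linear_on_cvg _ _ X (S ^~ w)) => //.
    split; first exact: Sl.
    by exists (beta * `|w|) => x Xx; rewrite mulrAC; exact: Sb.
  by move=> n; exact: (vP n).1.
have pk k : 0 <= 2 * k * p + k ^+ 2 * S w w.
  have : n.+1%:R^-1 + 2 * k * (S (v n) w - f w) + k ^+ 2 * S w w @[n --> \oo]
      --> 0 + 2 * k * p + k ^+ 2 * S w w.
    apply: cvgD; last exact: cvg_cst.
    apply: cvgD; first exact: cvg_harmonic.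
    by apply: cvgM => //; exact: cvg_cst.
  rewrite add0r => h; rewrite -(cvg_lim _ h)//.
  apply: limr_ge; first by apply: cvgP h.
  apply: nearW => n; have [Xn Jn] := vP n.
  have Xk : X (v n + k *: w) by apply: subspaceD => //; exact: subspaceZ.
  have := Jm _ Xk; rewrite JE//.
  move: (J _) (inf E) (n.+1%:R^-1) (2 * k * _) (k ^+ 2 * _) Jn
    => j i e p1 p2 Jn.
  lra.
have s0 : 0 <= S w w.
  by apply: le_trans (co w Xw); rewrite mulr_ge0 ?sqr_ge0// ltW.
have s1 : 0 < S w w + 1 by rewrite ltr_wpDl.
(* A quadratic without constant term is nonnegative only if its linear
   coefficient vanishes. The minimizer -p / S(w, w) is perturbed to avoid a
   separate treatment of w = 0. *)
have := pk (- p / (S w w + 1)).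
rewrite [leRHS](_ : _ = - (p ^+ 2 * ((S w w + 2) / (S w w + 1) ^+ 2)));
  last first.
  by field; rewrite gt_eqF.
rewrite oppr_ge0 pmulr_lle0; last by rewrite divr_gt0 ?exprn_gt0// ltr_wpDl.
move=> p2; apply/eqP; rewrite -subr_eq0 -/p -sqrf_eq0.
by rewrite eq_le p2 sqr_ge0.
Qed.

(** Let s(v, w) = S(v, w) + S(w, v), an inner product on [X], and let A v be the
    s-representative of S(v, .), so that s(A v, w) = S(v, w). With r_f the
    s-representative of f, the problem reads A v = r_f. The form s(A v, A w) is
    symmetric, bounded, and coercive because A is bounded below, so [riesz]
    yields v for which the residual e = r_f - A v is s-orthogonal to the range
    of A. Then S(e, e) = s(A e, e) = 0, hence e = 0. *)
Lemma lax_milgram X S (alpha beta : R) f :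
  closed_subspace X -> 0 < alpha -> 0 < beta ->
  bounded_coercive_form X S alpha beta -> bounded_linear_on X f ->
  exists2 r, X r & forall w, X w -> S r w = f w.
Proof.
move=> sX a0 b0 Sform blf; have [Sl Sr Sb co] := Sform.
pose s v w := S v w + S w v.
have sform : bounded_coercive_form X s (2 * alpha) (2 * beta).
  split.
  - by move=> w Xw k x y Xx Xy; rewrite /s Sl// Sr//; ring.
  - by move=> w Xw k x y Xx Xy; rewrite /s Sl// Sr//; ring.
  - move=> v w Xv Xw; apply: (le_trans (ler_normD _ _)).
    have := Sb v w Xv Xw; have := Sb w v Xw Xv; lra.
  - by move=> v Xv; have := co v Xv; rewrite /s; lra.
have ssym v w : s v w = s w v by rewrite /s addrC.
have sa0 : 0 < 2 * alpha by rewrite mulr_gt0.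
have [sl sr sb sco] := sform.
have Sbl v : X v -> bounded_linear_on X (S v).
  by move=> Xv; split; [exact: Sr|exists (beta * `|v|) => w Xw; exact: Sb].
pose rep g := xget 0 [set r | X r /\ forall w, X w -> s r w = g w].
have repP g : bounded_linear_on X g ->
    X (rep g) /\ forall w, X w -> s (rep g) w = g w.
  move=> bg; have [r Xr rg] := @riesz X s _ _ g sX sa0 sform
    (fun v w _ _ => ssym v w) bg.
  by apply: (@xgetPex _ 0 [set r | X r /\ forall w, X w -> s r w = g w]);
    exists r.
pose A v := rep (S v).
have XA v : X v -> X (A v) by move=> /Sbl/repP[].
have sA v w : X v -> X w -> s (A v) w = S v w by move=> /Sbl/repP[_]; exact.
have Alin k x y : X x -> X y -> A (k *: x + y) = k *: A x + A y.
  move=> Xx Xy; have Xz : X (k *: x + y).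
    by apply: subspaceD => //; exact: subspaceZ.
  have XkA : X (k *: A x + A y).
    by apply: subspaceD => //; [apply: subspaceZ => //|]; exact: XA.
  apply/eqP; rewrite -subr_eq0; apply/eqP; set z := _ - _.
  have Xz' : X z by apply: subspaceB => //; exact: XA.
  apply: (@coercive_eq0 X s _ _ _ sa0 sform) => //.
  rewrite {1}/z (linear_onB X (s ^~ z))//; [|exact: sl|exact: XA].
  by rewrite sl//; [|exact: XA..]; rewrite !sA// Sl// subrr.
have Aub v : X v -> 2 * alpha * `|A v| <= beta * `|v|.
  move=> Xv; have [->|] := eqVneq (A v) 0.
    by rewrite normr0 mulr0 mulr_ge0// ltW.
  rewrite -normr_gt0 => A0; rewrite -(ler_pM2r A0) -[leLHS]mulrA -expr2.
  apply: (le_trans (sco _ (XA _ Xv))); rewrite sA//; last exact: XA.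
  by apply: (le_trans (ler_norm _)); apply: Sb => //; exact: XA.
have Alb v : X v -> alpha * `|v| <= 2 * beta * `|A v|.
  move=> Xv; have [->|] := eqVneq v 0.
    by rewrite normr0 mulr0 mulr_ge0// mulr_ge0// ltW.
  rewrite -normr_gt0 => v0; rewrite -(ler_pM2r v0) -[leLHS]mulrA -expr2.
  apply: (le_trans (co _ Xv)); rewrite -sA//.
  by apply: (le_trans (ler_norm _)); apply: sb => //; exact: XA.
have Aub' v : X v -> `|A v| <= beta / (2 * alpha) * `|v|.
  by move=> Xv; rewrite mulrAC ler_pdivlMr// mulrC; exact: Aub.
have Alb' v : X v -> alpha / (2 * beta) * `|v| <= `|A v|.
  by move=> Xv; rewrite mulrAC ler_pdivrMr ?mulr_gt0// mulrC [leRHS]mulrC mulrC;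
    exact: Alb.
(* The normal equations of A v = r_f; note s(r_f, A w) = f(A w). *)
pose T v w := s (A v) (A w).
pose c := beta / (2 * alpha).
have c0 : 0 <= c by rewrite divr_ge0// ltW.
have Tform : bounded_coercive_form X T
    (2 * alpha * (alpha / (2 * beta)) ^+ 2) (2 * beta * c ^+ 2).
  split.
  - by move=> w Xw k x y Xx Xy; rewrite /T Alin// sl//; exact: XA.
  - by move=> w Xw k x y Xx Xy; rewrite /T Alin// sr//; exact: XA.
  - move=> v w Xv Xw; apply: (le_trans (sb _ _ (XA _ Xv) (XA _ Xw))).
    rewrite (_ : 2 * beta * c ^+ 2 * `|v| * `|w| =
                 2 * beta * ((c * `|v|) * (c * `|w|))); last by ring.
    rewrite -[leLHS]mulrA ler_wpM2l//; first by rewrite mulr_ge0// ltW.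
    by rewrite ler_pM//; exact: Aub'.
  - move=> v Xv; apply: le_trans (sco _ (XA _ Xv)).
    rewrite -[leLHS]mulrA -exprMn ler_wpM2l// ?(ltW sa0)//.
    rewrite ler_pXn2r// ?nnegrE// ?mulr_ge0// ?Alb'//.
      exact: ltW.
    by rewrite invr_ge0 mulr_ge0// ltW.
have fAbl : bounded_linear_on X (f \o A).
  have [lf [L fL]] := blf; split.
    by move=> k x y Xx Xy /=; rewrite Alin// lf//; exact: XA.
  exists (`|L| * c) => x Xx /=; apply: (le_trans (fL _ (XA _ Xx))).
  rewrite -[leRHS]mulrA; apply: (@le_trans _ _ (`|L| * `|A x|)).
    by rewrite ler_wpM2r// ler_norm.
  by rewrite ler_wpM2l//; exact: Aub'.
have Ta0 : 0 < 2 * alpha * (alpha / (2 * beta)) ^+ 2.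
  by rewrite mulr_gt0// exprn_gt0// divr_gt0// mulr_gt0.
have [v Xv vT] := @riesz X T _ _ _ sX Ta0 Tform (fun v w _ _ => ssym _ _) fAbl.
exists v => //.
have [Xf sf] := repP f blf.
pose e := rep f - A v.
have Xe : X e by apply: subspaceB => //; exact: XA.
have e0 : e = 0.
  apply: (@coercive_eq0 X S _ _ _ a0 Sform) => //.
  rewrite -sA// ssym {1}/e (linear_onB X (s ^~ (A e)))//;
    [|exact/sl/XA|exact: XA].
  by rewrite -[s (A v) _]/(T v e) vT// sf ?subrr//; exact: XA.
move=> w Xw; rewrite -sA// -sf//; congr s.
by apply/esym/eqP; rewrite -subr_eq0; apply/eqP.
Qed.

End LaxMilgram.

(** * Strong monotonicity and lower bounds *)

(** The mean value theorem applied to g(t) - (dg(0) t + c t^2 / 2), whose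
    derivative is nonnegative for positive t. *)
Lemma quadratic_lower_bound (R : realType) (g dg : R -> R) (c : R) :
  (forall t : R, is_derive t (1 : R) g (dg t)) ->
  (forall t, 0 < t -> c * t <= dg t - dg 0) ->
  g 0 + dg 0 + c / 2 <= g 1.
Proof.
move=> gd dgc.
pose h := fun t : R => g t - (dg 0 * t + c / 2 * t ^+ 2).
have hd (t : R) : is_derive t (1 : R) h (dg t - dg 0 - c * t).
  have gt := gd t.
  rewrite /h; apply: is_derive_eq.
  by rewrite /GRing.scale /=; field.
have hc : {within `[0, 1], continuous h}.
  by apply: derivable_within_continuous => x _; exact: ex_derive.
have [t t01 ht] := MVT ltr01 (fun x _ => hd x) hc.
have := dgc t; move: t01; rewrite in_itv /= => /andP[t0 _] /(_ t0) dgt.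
have : 0 <= h 1 - h 0 by rewrite ht subr0 mulr1 subr_ge0.
by rewrite /h; lra.
Qed.

Section Potential.
Context {R : realType} {Y : completeNormedModType R}.
Implicit Types (K : set Y) (H : Y -> R) (dH : Y -> dual Y).

Lemma dual_bounded_linear_on (X : set Y) (f : dual Y) : bounded_linear_on X f.
Proof.
split; first by move=> k x y _ _; exact: linearP.
exists (dual_norm f) => x _.
have [->|x0] := eqVneq x 0; first by rewrite linear0 !normr0 mulr0.
have nx0 : 0 < `|x| by rewrite normr_gt0.
have := @dual_norm_ub _ _ f (`|x|^-1 *: x).
rewrite linearZ /= normrZ normfV normr_id mulVf ?gt_eqF// => /(_ (lexx _)).
by rewrite normrM normfV normr_id mulrC ler_pdivrMr.
Qed.

(** Gateaux derivatives on [K] are one-sided. As [K] is invariant under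
    translations by its difference set, both directions w and -w are
    admissible at every point of the line, and linearity of the derivative
    makes the two one-sided limits agree. *)
Lemma gateaux_is_derive K H dH (x w : Y) (t : R) :
  property_K K -> is_gateaux_derivative K H dH ->
  K x -> difference_set K w ->
  is_derive t (1 : R) (fun t : R => H (x + t *: w)) (dH (x + t *: w) w).
Proof.
move=> [sX KX] gH Kx Xw.
have Kline s : K (x + s *: w).
  by rewrite addrC; apply: KX => //; exact: subspaceZ.
set z := x + t *: w.
pose q := fun h : R => h^-1 *: (H (z + h *: w) - H z : R^o).
have step s : x + (t + s) *: w = z + s *: w by rewrite scalerDl addrA.
have right : q h @[h --> 0^'+] --> dH z w.
  have := gH z (z + w) (Kline t); rewrite [z + w]addrC addrK => /(_ _).
  have -> : w + z = x + (t + 1) *: w by rewrite step scale1r addrC.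
  move=> /(_ (Kline _)).
  by apply: cvg_trans; apply: near_eq_cvg; near=> h; rewrite /q /= mulrC.
have left : q h @[h --> 0^'-] --> dH z w.
  apply/cvg_at_leftNP; rewrite oppr0.
  have := gH z (z - w) (Kline t); rewrite [z - w]addrC addrK => /(_ _).
  have -> : - w + z = x + (t + -1) *: w by rewrite step scaleN1r addrC.
  move=> /(_ (Kline _)) /cvgN; rewrite linearN opprK.
  apply: cvg_trans; apply: near_eq_cvg; near=> h.
  by rewrite /q /= [- h *: w]scaleNr -scalerN invrN scaleNr; congr (- _);
    rewrite mulrC.
have qd := cvg_at_right_left_dnbhs right left.
have E : (fun h : R =>
    h^-1 *: (((fun t : R => H (x + t *: w)) \o shift t) (h *: 1) -
    H (x + t *: w))) = q.
  apply/funext => h; rewrite /q /= /shift /=.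
  by rewrite -[h *: 1 + t]/(h * 1 + t) mulr1 [h + t]addrC step.
split; first by rewrite /derivable E; exact: cvgP qd.
by rewrite /derive E; exact: cvg_lim qd.
Unshelve. all: end_near. Qed.

(** Along t |-> x + t (y - x), strong monotonicity tested between the points at
    t and at 0 carries a factor t^2 on the left and t on the right; dividing by
    t leaves the linear growth that [quadratic_lower_bound] asks for. *)
Lemma strongly_monotone_lower_bound K H dH (x y : Y) (nu : R) :
  property_K K -> is_gateaux_derivative K H dH ->
  (forall u v, K u -> K v -> nu * `|u - v| ^+ 2 <= (dH u - dH v) (u - v)) ->
  K x -> K y ->
  H x + dH x (y - x) + nu * `|y - x| ^+ 2 / 2 <= H y.
Proof.
move=> pK gH mono Kx Ky; have [sX KX] := pK.
have Xw : difference_set K (y - x) by exists y => //; exists x.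
have := @quadratic_lower_bound R (fun t => H (x + t *: (y - x)))
  (fun t => dH (x + t *: (y - x)) (y - x)) (nu * `|y - x| ^+ 2).
rewrite /= scale0r addr0 scale1r [x + (y - x)]addrC subrK; apply.
  by move=> t; exact: (gateaux_is_derive K).
move=> t t0.
have Kt : K (x + t *: (y - x)).
  by rewrite addrC; apply: KX => //; exact: subspaceZ.
have := mono _ _ Kt Kx.
rewrite [_ + _ - x]addrC addrA addNr add0r linearZ /= normrZ gtr0_norm// exprMn.
rewrite -[leRHS]/(t * (dH (x + t *: (y - x)) (y - x) - dH x (y - x))).
rewrite [leLHS](_ : _ = t * (nu * `|y - x| ^+ 2 * t)); last by ring.
by rewrite ler_pM2l.
Qed.

(** The quadratic term of [strongly_monotone_lower_bound] absorbs the linear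
    one, as dH x is bounded. *)
Lemma strongly_monotone_has_lbound K H dH (nu : R) (x : Y) :
  property_K K -> is_gateaux_derivative K H dH -> 0 < nu ->
  (forall u v, K u -> K v -> nu * `|u - v| ^+ 2 <= (dH u - dH v) (u - v)) ->
  K x -> has_lbound [set H y | y in K].
Proof.
move=> pK gH nu0 mono Kx.
have [_ [L dHL]] := dual_bounded_linear_on setT (dH x).
exists (H x - L ^+ 2 / (2 * nu)) => _ [y Ky <-].
apply: le_trans (strongly_monotone_lower_bound K H dH x y nu pK gH mono Kx Ky).
have : - (L * `|y - x|) <= dH x (y - x).
  by rewrite lerNl (le_trans (ler_norm _))// normrN dHL.
rewrite -addrA lerD2l => h; rewrite -(lerD2r (L * `|y - x|)) -subr_ge0.
(* Completing the square. *)
apply: (@le_trans _ _ ((nu * `|y - x| - L) ^+ 2 / (2 * nu))).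
  by rewrite divr_ge0 ?sqr_ge0// mulr_ge0// ltW.
rewrite [leLHS](_ : _ =
    nu * `|y - x| ^+ 2 / 2 - L * `|y - x| + L ^+ 2 / (2 * nu)).
  lra.
by field; rewrite gt_eqF.
Qed.

Lemma solves_unique K dH (nu : R) (x y : Y) :
  0 < nu ->
  (forall u v, K u -> K v -> nu * `|u - v| ^+ 2 <= (dH u - dH v) (u - v)) ->
  solves K dH x -> solves K dH y -> x = y.
Proof.
move=> nu0 mono [Kx sx] [Ky sy].
have Xd : difference_set K (x - y) by exists x => //; exists y.
have := mono _ _ Kx Ky.
rewrite -[leRHS]/(dH x (x - y) - dH y (x - y)) sx// sy// subr0.
rewrite pmulr_rle0// => h.
apply/eqP; rewrite -subr_eq0 -normr_eq0 -sqrf_eq0.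
by rewrite eq_le h sqr_ge0.
Qed.

End Potential.

(** * The damped iteration *)

Section Iteration.
Context {R : realType} {Y : completeNormedModType R}.
Implicit Types (K : set Y) (H : Y -> R) (dH : Y -> dual Y).

Lemma form_bounded_coercive K (a : Y -> Y -> Y -> R) b :
  property_A1 K a b -> property_A2 K a ->
  exists alpha beta : R, [/\ 0 < alpha, 0 < beta &
    forall u, K u ->
      bounded_coercive_form (difference_set K) (a u) alpha beta].
Proof.
move=> A1 [alpha [beta [a0 b0 ab]]].
exists alpha, beta; split => // u Ku.
have [al ar _] := A1 u Ku; have [aub aco] := ab u Ku.
split => //.
  by move=> w Xw k x y _ _; exact: (al w Xw).
move=> v w Xv Xw; rewrite ler_norml aub// andbT lerNl.
have := aub (- v) w Xw; rewrite normrN; congr (_ <= _).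
(* Writing -v as -2v + v yields a(-v, w) = - a(v, w) from a single instance of
   linearity. *)
have := al w Xw (-2) v v I I.
rewrite !scaleNr scaler_nat mulr2n opprD addrNK.
lra.
Qed.

(** The direction is the chosen value of [xget], so its defining equation is
    available only once existence is known from [lax_milgram]. *)
Lemma kacanov_directionP K (a : Y -> Y -> Y -> R) b dH (u : Y) :
  property_K K -> property_A1 K a b -> property_A2 K a -> K u ->
  difference_set K (kacanov_direction K a dH u) /\
  forall w, difference_set K w -> a u (kacanov_direction K a dH u) w = dH u w.
Proof.
move=> pK A1 A2 Ku.
have [alpha [beta [a0 b0 form]]] := form_bounded_coercive _ _ _ A1 A2.
have [r Xr rP] := lax_milgram _ _ _ _ _ pK.1 a0 b0 (form u Ku)
  (dual_bounded_linear_on _ (dH u)).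
apply: (@xgetPex _ 0 [set rho | difference_set K rho /\
  forall w, difference_set K w -> a u rho w = dH u w]).
by exists r.
Qed.

Lemma kacanov_iterates_in K (a : Y -> Y -> Y -> R) b dH
    (delta : Y -> R) (u0 : Y) n :
  property_K K -> property_A1 K a b -> property_A2 K a -> K u0 ->
  K (kacanov K a dH delta u0 n).
Proof.
move=> pK A1 A2 Ku0; elim: n => // n IH.
rewrite /kacanov iterS -/(kacanov _ _ _ _ _ n) addrC; apply: pK.2 => //.
rewrite -scaleNr; apply: subspaceZ; first exact: pK.1.
by have [] := kacanov_directionP _ _ _ dH _ pK A1 A2 IH.
Qed.

Lemma bounded_decreasing_increments (h : nat -> R) :
  (forall n, h n.+1 <= h n) -> has_lbound (range h) ->
  h n - h n.+1 @[n --> \oo] --> 0.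
Proof.
move=> dh lh.
have ch : cvgn h.
  by apply: nonincreasing_is_cvgn => //; apply/nonincreasing_seqP.
rewrite -(subrr (limn h)); apply: cvgB => //.
by rewrite (cvg_shiftS h).
Qed.

End Iteration.

Theorem theorem2p5 (R : realType) (Y : completeNormedModType R)
    (K : set Y) (a : Y -> Y -> Y -> R) (b : Y -> Y -> R)
    (G B : Y -> R) (dG dB dH : Y -> dual Y) (delta : Y -> R) (u0 : Y) :
  let H := fun u => G u - B u in
  let u := kacanov K a dH delta u0 in
  reflexive_space Y ->
  K !=set0 -> closed K -> convex_set K ->
  property_K K ->
  property_A1 K a b ->
  property_A2 K a ->
  property_A3 K a b G B dG dB ->
  property_A4 K H dH ->
  weakly_continuous_on K dH ->
  (forall v, K v -> 0 < delta v) ->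
  K u0 ->
  damping_condition H delta u ->
  exists ustar : Y,
    unique (solves K dH) ustar /\ u n @[n --> \oo] --> ustar.
Proof.
move=> H u _ _ cK _ pK A1 A2 _ [gH [nu nu0 mono]] wc _ Ku0.
move=> [dmin [gam [d0 g0 damp]]].
have [alpha [beta [a0 b0 form]]] := form_bounded_coercive _ _ _ A1 A2.
have Ku n : K (u n) by exact: (kacanov_iterates_in K a b).
pose rho n := kacanov_direction K a dH (u n).
have rhoP n : difference_set K (rho n) /\
    forall w, difference_set K w -> a (u n) (rho n) w = dH (u n) w.
  exact: (kacanov_directionP K a b).
pose e n := H (u n) - H (u n.+1).
have e0 : e n @[n --> \oo] --> 0.
  apply: (bounded_decreasing_increments (H \o u)) => [n|] /=.
    rewrite -subr_ge0; apply: le_trans (damp n).2.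
    by rewrite mulr_ge0 ?sqr_ge0// ltW.
  have [M HM] := strongly_monotone_has_lbound K H dH nu u0 pK gH nu0 mono Ku0.
  by exists M => _ [n _ <-]; apply: HM; exists (u n).
pose C := gam * dmin ^+ 2.
have C0 : 0 < C by rewrite mulr_gt0// exprn_gt0.
(* The step has norm delta(u_n) |rho_n| >= dmin |rho_n|. *)
have rho_e n : C * `|rho n| ^+ 2 <= e n.
  have [dn] := damp n; apply: le_trans.
  have -> : u n.+1 - u n = - (delta (u n) *: rho n).
    by rewrite [u n.+1]/u /kacanov iterS -/(kacanov _ _ _ _ _ n) -/(u n)
      addrC addKr.
  have dn0 : 0 < delta (u n) by apply: lt_le_trans dn.
  rewrite normrN normrZ gtr0_norm// -mulrA ler_wpM2l ?(ltW g0)// exprMn.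
  by rewrite ler_wpM2r ?sqr_ge0// ler_pXn2r// nnegrE ltW.
have dHrho n w : difference_set K w ->
    `|dH (u n) w| <= beta * `|rho n| * `|w|.
  move=> Xw; have [Xr <-//] := rhoP n.
  by have [_ _ aub _] := form _ (Ku n); exact: aub.
have ucvg : cvgn u.
  apply: (@cvg_of_sqr_bound _ _ (nu ^+ 2 * C / (2 * beta ^+ 2)) e) => //.
    by rewrite divr_gt0 ?mulr_gt0// exprn_gt0.
  move=> m n.
  have Xd : difference_set K (u m - u n) by exists (u m) => //; exists (u n).
  have dle : nu * `|u m - u n| <= beta * (`|rho m| + `|rho n|).
    have [->|] := eqVneq (u m - u n) 0.
      by rewrite normr0 mulr0 mulr_ge0 ?addr_ge0// ltW.
    rewrite -normr_gt0 => um0; rewrite -(ler_pM2r um0) -[leLHS]mulrA -expr2.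
    apply: (le_trans (mono _ _ (Ku m) (Ku n))).
    rewrite -[leLHS]/(dH (u m) (u m - u n) - dH (u n) (u m - u n)).
    apply: (le_trans (ler_norm _)); apply: (le_trans (ler_normB _ _)).
    by rewrite mulrDr mulrDl lerD// dHrho.
  have : (nu * `|u m - u n|) ^+ 2 <= (beta * (`|rho m| + `|rho n|)) ^+ 2.
    by rewrite ler_pXn2r// nnegrE mulr_ge0 ?addr_ge0// ltW.
  rewrite !exprMn => sq.
  have sq2 : (`|rho m| + `|rho n|) ^+ 2 <= 2 * (`|rho m| ^+ 2 + `|rho n| ^+ 2).
    rewrite -subr_ge0 [leRHS](_ : _ = (`|rho m| - `|rho n|) ^+ 2); last by ring.
    exact: sqr_ge0.
  have b2 : 0 < beta ^+ 2 by rewrite exprn_gt0.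
  rewrite mulrAC ler_pdivrMr ?mulr_gt0//.
  apply: (@le_trans _ _
    (C * (beta ^+ 2 * (2 * (`|rho m| ^+ 2 + `|rho n| ^+ 2))))).
    rewrite [leLHS](_ : _ = C * (nu ^+ 2 * `|u m - u n| ^+ 2)); last by ring.
    rewrite ler_pM2l//; apply: (le_trans sq).
    by rewrite ler_pM2l.
  rewrite [leLHS](_ : _ =
    (C * `|rho m| ^+ 2 + C * `|rho n| ^+ 2) * (2 * beta ^+ 2)).
    by rewrite ler_wpM2r ?lerD// mulr_ge0// ltW.
  by ring.
have Kstar : K (limn u).
  by apply: (closed_cvg K cK _ _ ucvg); apply: nearW => n; exact: Ku.
have sstar : solves K dH (limn u).
  split=> // w Xw.
  have dHw := wc u (limn u) Ku Kstar ucvg w Xw.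
  (* Only squares of dH(u_n) w are bounded by the decrements e_n, so the limit
     is identified through its square. *)
  have sqw : dH (u n) w ^+ 2 @[n --> \oo] --> dH (limn u) w ^+ 2.
    by rewrite expr2; under eq_fun do rewrite expr2; exact: cvgM.
  have sq0 : dH (u n) w ^+ 2 @[n --> \oo] --> 0.
    have ub0 : (beta * `|w|) ^+ 2 / C * e n @[n --> \oo] --> 0.
      by rewrite -(mulr0 ((beta * `|w|) ^+ 2 / C)); apply: cvgMr.
    apply: squeeze_cvgr ub0; last exact: cvg_cst.
    apply: nearW => n; rewrite sqr_ge0 /= mulrAC ler_pdivlMr//.
    rewrite mulrC -real_normK ?num_real//.
    apply: (@le_trans _ _ (C * (beta * `|rho n| * `|w|) ^+ 2)).
      by rewrite ler_pM2l// ler_pXn2r ?nnegrE ?mulr_ge0 ?dHrho// ltW.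
    rewrite [leLHS](_ : _ = (beta * `|w|) ^+ 2 * (C * `|rho n| ^+ 2));
      last by ring.
    by rewrite ler_wpM2l ?sqr_ge0.
  by apply/eqP; rewrite -sqrf_eq0 -(cvg_lim _ sqw)// (cvg_lim _ sq0).
exists (limn u); split=> //; split=> // v sv.
exact: (solves_unique K dH nu).
Qed.
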